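(* Let $\mathbb{K}$ be a field of characteristic zero, let $a_1,\dots,a_k\in\mathbb{K}$, and let $(\alpha_j,\beta_j)$, $1\le j\le k$, be pairs of nonnegative integers with $\alpha_1\le\dots\le\alpha_k$. Suppose $1\le\ell<k$ is the smallest index such that $\alpha_{\ell+1}>\alpha_1+\binom{\ell}{2}$, and let \[Q=\sum_{j=1}^\ell a_jX^{\alpha_j}Y^{\beta_j},\qquad R=\sum_{j=\ell+1}^k a_jX^{\alpha_j}Y^{\beta_j},\qquad P=Q+R.\] Then for every $F=uX+vY+w$ with $u,v,w\in\mathbb{K}$ and $uvw\neq0$, \[\operatorname{mult}_F(P)=\min\bigl(\operatorname{mult}_F(Q),\operatorname{mult}_F(R)\bigr).\]
   Context: $\operatorname{mult}_F(P)$ denotes the largest integer $\mu$ such that $F^\mu$ divides $P$, with the convention $\operatorname{mult}_F(0)=+\infty$. *)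

(* Defs.v *)
From HB Require Import structures.
From mathcomp Require Import all_boot all_order all_algebra.
From Stdlib Require Import ClassicalEpsilon.
Set Implicit Arguments. Unset Strict Implicit. Unset Printing Implicit Defensive.
Import Order.TTheory GRing.Theory Num.Theory.
Local Open Scope ring_scope.

(* Bivariate polynomials K[X,Y] are represented as {poly {poly K}}:
   the inner variable is X, the outer variable is Y. *)
Notation bipoly K := {poly {poly K}}.

Definition bX {K : fieldType} : bipoly K := ('X)%:P.
Definition bY {K : fieldType} : bipoly K := 'X.
Definition bC {K : fieldType} (c : K) : bipoly K := (c%:P)%:P.

Definition bmono {K : fieldType} (c : K) (a b : nat) : bipoly K :=
  bC c * bX ^+ a * bY ^+ b.

Definition bdvd {K : fieldType} (A B : bipoly K) : Prop :=
  exists g : bipoly K, B = A * g.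

(* mult_F(P): the largest mu such that F^mu divides P (Some mu),
   or None (= +infinity) if there is no largest such mu (e.g. P = 0). *)
Definition mult {K : fieldType} (F P : bipoly K) : option nat :=
  match excluded_middle_informative
          (exists m : nat, bdvd (F ^+ m) P /\ ~ bdvd (F ^+ m.+1) P) with
  | left H => Some (proj1_sig (constructive_indefinite_description _ H))
  | right _ => None
  end.

Definition omin (x y : option nat) : option nat :=
  match x, y with
  | None, _ => y
  | _, None => x
  | Some m, Some n => Some (minn m n)
  end.

(* Main.v *)
Require Import Defs.
From HB Require Import structures.
From mathcomp Require Import all_boot all_order all_algebra.
From mathcomp Require Import zify ring.
From Stdlib Require Import ClassicalEpsilon.
Import Order.TTheory GRing.Theory Num.Theory.
Local Open Scope ring_scope.

(** Up to a constant, F = Y - L with L = -(u X + w) / v, so F divides P iff P(X, L) = 0.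
    Let theta denote the Euler operator, X d/dX or Y d/dY. As L(0) <> 0, X does not divide L,
    and a Wronskian argument bounds the order at 0 of a nonzero sum of m terms
    a_j X^(alpha_j) L^(beta_j): if the terms are linearly independent, the matrix
    theta^i (X^(alpha_j) L^(beta_j)) is, up to factors X^(alpha_j) by columns and powers of L,
    a matrix of polynomials whose determinant is nonzero of degree at most 'C(m, 2), whence
    order <= alpha_r + 'C(m, 2) for every r with a_r <> 0; if they are dependent, a term can be
    dropped. For Q(X, L) the order is thus at most alpha_1 + 'C(l, 2), whereas X^(alpha_(l+1))
    divides R(X, L): if F divides Q + R it divides Q. For multiplicities, theta in the variable Y
    only changes the coefficients a_j into a_j beta_j, and if F^n divides P, then F^(n+1) divides
    P iff F divides theta^n P. *)

(** * The Euler operator theta on coefficients *)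

Definition euler {R : comNzRingType} (p : {poly R}) : {poly R} := 'X * p^`().

Lemma coef_iter_euler {R : comNzRingType} (i : nat) (p : {poly R}) (n : nat) :
  (iter i euler p)`_n = p`_n * n%:R ^+ i.
Proof.
elim: i => [|i IH] /=; first by rewrite expr0 mulr1.
rewrite coefXM; case: n IH => [|n] IH /=.
  by rewrite exprS mul0r mulr0.
by rewrite coef_deriv IH exprSr mulrA mulr_natr.
Qed.

Lemma iter_euler_sum {R : comNzRingType} (i m : nat) (c : 'I_m -> R)
    (g : 'I_m -> {poly R}) :
  iter i euler (\sum_j c j *: g j) = \sum_j c j *: iter i euler (g j).
Proof.
apply/polyP=> n; rewrite coef_iter_euler !coef_sum mulr_suml.
by apply: eq_bigr => j _; rewrite !coefZ coef_iter_euler mulrA.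
Qed.

Lemma dvdXn_iter_euler {K : fieldType} (N i : nat) (f : {poly K}) :
  'X^N %| f -> 'X^N %| iter i euler f.
Proof.
move=> /dvdpP [q ->]; elim: i => [|i /dvdpP [h /= ->]] /=; first exact: dvdp_mull.
apply/dvdpP; exists (euler h + N%:R * h); rewrite /euler derivM derivXn.
case: N => [|N]; first by rewrite expr0 mulr0n mul0r mulr0 !addr0 !mulr1.
by rewrite /= -mulr_natl exprS; ring.
Qed.

(** * Linear dependence of polynomials killed by an operator in theta *)

Lemma natr_inj_pchar0 {K : fieldType} :
  [pchar K] =i pred0 -> injective (fun n : nat => n%:R : K).
Proof.
move=> /pcharf0P char0 m n /eqP; wlog le_mn : m n / (m <= n)%N => [IH|].
  by case: (leqP m n) => [/IH //|/ltnW /IH]; rewrite eq_sym => h /h.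
rewrite eq_sym -subr_eq0 -natrB // char0 subn_eq0 => le_nm.
by apply/eqP; rewrite eqn_leq le_mn le_nm.
Qed.

(* At the lowest order [s] in ['X] of the operator, the coefficient of ['X^n] gets
   multiplied by [chi n]; so [chi] vanishes at the valuation of every function the
   operator kills, and [chi] has fewer than [m] roots. *)
Lemma euler_operator_dependence {K : fieldType} (char0 : [pchar K] =i pred0)
    (m : nat) (c g : 'I_m -> {poly K}) (i0 : 'I_m) :
  c i0 != 0 -> (forall j, \sum_i c i * iter i euler (g j) = 0) ->
  exists b : 'I_m -> K, (exists j, b j != 0) /\ \sum_j b j *: g j = 0.
Proof.
move=> ci0 kill.
have exs : exists s, [exists i, (c i)`_s != 0].
  exists (size (c i0)).-1; apply/existsP; exists i0.
  by rewrite -/(lead_coef _) lead_coef_eq0.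
case: (ex_minnP exs) => s /existsP [i1 ci1] smin.
have cs0 i k : (k < s)%N -> (c i)`_k = 0.
  move=> lt_ks; apply: contraTeq lt_ks => nz; rewrite -leqNgt smin //.
  by apply/existsP; exists i.
pose chi := \sum_(i < m) (c i)`_s *: 'X^i.
have chiE (x : K) : chi.[x] = \sum_(i < m) (c i)`_s * x ^+ i.
  by rewrite horner_sum; apply: eq_bigr => i _; rewrite hornerZ hornerXn.
have chi_neq0 : chi != 0.
  apply: contraNneq ci1 => chi0.
  have: chi`_i1 = 0 by rewrite chi0 coef0.
  rewrite coef_sum (bigD1 i1) //= coefZ coefXn eqxx mulr1 big1 ?addr0 => [->|i ne] //.
  by rewrite coefZ coefXn eq_sym (inj_eq val_inj) (negbTE ne) mulr0.
have size_chi : (size chi <= m)%N.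
  apply: (leq_trans (size_sum _ _ _)); apply/bigmax_leqP => i _.
  by rewrite (leq_trans (size_scale_leq _ _)) // size_polyXn.
pose N := \max_j size (g j).
(* [N] exceeds the degree of every [g j], so the order of a nonzero combination is below [N]; in
   characteristic zero the members of [S] give distinct roots of [chi]. *)
pose S := [pred n : 'I_N | chi.[(n : nat)%:R] == 0].
have ltSm : (#|S| < m)%N.
  apply: leq_trans size_chi.
  have := @max_poly_roots _ chi [seq (nat_of_ord n)%:R | n <- enum S] chi_neq0.
  rewrite size_map -cardE; apply.
    by apply/allP => _ /mapP [n nS ->]; rewrite /root; move: nS; rewrite mem_enum.
  rewrite map_inj_uniq ?enum_uniq // => x y /(natr_inj_pchar0 char0).
  exact: val_inj.
(* There are [m] unknowns and fewer equations: some nonzero [b] makes the combination vanish in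
   every degree of [S]. *)
pose B := \matrix_(j < m, t < #|S|) (g j)`_(enum_val t).
have : kermx B != 0.
  rewrite kermx_eq0 -row_leq_rank -ltnNge.
  exact: leq_ltn_trans (rank_leq_col B) ltSm.
case/rowV0Pn => b /sub_kermxP bB bneq0.
exists (b 0); split.
  by have [j bj] := rV0Pn _ bneq0; exists j.
set f := \sum_j _.
have f_kill : \sum_i c i * iter i euler f = 0.
  rewrite (eq_bigr (fun i : 'I_m => \sum_j b 0 j *: (c i * iter i euler (g j)))).
    rewrite exchange_big big1 // => j _; by rewrite -scaler_sumr kill scaler0.
  move=> i _; rewrite iter_euler_sum mulr_sumr; apply: eq_bigr => j _.
  by rewrite scalerAr.
have fS (n : 'I_N) : n \in S -> f`_n = 0.
  move=> nS; have := congr1 (fun M : 'rV_#|S| => M 0 (enum_rank_in nS n)) bB.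
  rewrite mxE [RHS]mxE; apply: etrans; rewrite /f coef_sum; apply: eq_bigr => j _.
  by rewrite coefZ mxE enum_rankK_in.
apply/eqP; apply: contraT => f_neq0.
have exn : exists n, f`_n != 0 by exists (size f).-1; rewrite -/(lead_coef f) lead_coef_eq0.
case: (ex_minnP exn) => n fn nmin.
have f0 k : (k < n)%N -> f`_k = 0.
  by move=> lt_kn; apply: contraTeq lt_kn => /nmin; rewrite -leqNgt.
have lt_nN : (n < N)%N.
  rewrite ltnNge; apply: contra fn => le_Nn; rewrite /f coef_sum big1 // => j _.
  rewrite coefZ [X in _ * X]nth_default ?mulr0 //.
  exact: leq_trans (leq_bigmax _) le_Nn.
have /fS /= fn0 : Ordinal lt_nN \in S; last by rewrite fn0 eqxx in fn.
rewrite inE /= chiE.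
have := congr1 (fun p : {poly K} => p`_(s + n)) f_kill.
rewrite coef0 coef_sum => sum0.
rewrite -(mulIr_eq0 _ (mulIf fn)) mulr_suml; apply/eqP/(etrans _ sum0)/eq_bigr => i _.
have lt_s : (s < (s + n).+1)%N by rewrite ltnS leq_addr.
rewrite coefM (bigD1 (Ordinal lt_s)) //= addKn coef_iter_euler big1 ?addr0.
  by rewrite mulrAC mulrA.
move=> k; rewrite -(inj_eq val_inj) /= neq_ltn => /orP [lt_ks|lt_sk].
  by rewrite cs0 ?mul0r.
by rewrite coef_iter_euler f0 ?mul0r ?mulr0 //; have := ltn_ord k; lia.
Qed.

(** * The reduced Wronskian matrix and its degree *)

(* Writing g = X^al L^be, this is the polynomial L^i (euler^i g) / g (see [log_eulerE]). *)
Fixpoint log_euler {K : fieldType} (L : {poly K}) (al be i : nat) : {poly K} :=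
  if i is i'.+1 then
    let p := log_euler L al be i' in
    (al%:R * L + (be%:R - i'%:R) * euler L) * p + L * euler p
  else 1.

Lemma log_eulerE {K : fieldType} (L : {poly K}) (al be i : nat) :
  L ^+ i * iter i euler ('X^al * L ^+ be) = 'X^al * L ^+ be * log_euler L al be i.
Proof.
elim: i => [|i IH] /=; first by rewrite expr0 mul1r mulr1.
set h := iter i _ _ in IH *; set p := log_euler _ _ _ _ in IH *.
have eM (x y : {poly K}) : euler (x * y) = euler x * y + x * euler y.
  by rewrite /euler derivM; ring.
have eX n (x : {poly K}) : x * euler (x ^+ n) = n%:R * euler x * x ^+ n.
  elim: n => [|n IHn]; first by rewrite expr0 /euler derivE; ring.
  by rewrite exprS eM mulrDr [x * (x * _)]mulrA -[x * x * _]mulrA IHn -natr1; ring.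
have eXn : euler 'X^al = al%:R * 'X^al :> {poly K}.
  rewrite /euler derivXn; case: al {IH h p} => [|n]; first by rewrite mulr0 mul0r.
  by rewrite mulrnAr -exprS mulr_natl.
(* In [L] times theta of the induction hypothesis, the product rule on [L ^+ i] is the source of
   [- i'%:R] in [log_euler]. *)
have := congr1 (fun q => L * euler q) IH; rewrite /= !eM eXn => E.
have -> : L ^+ i.+1 * euler h =
    L * (euler (L ^+ i) * h + L ^+ i * euler h) - L * euler (L ^+ i) * h.
  by rewrite exprS; ring.
rewrite E eX -[_ * L ^+ i * h]mulrA IH.
have -> : L * ((al%:R * 'X^al * L ^+ be + 'X^al * euler (L ^+ be)) * p +
      'X^al * L ^+ be * euler p) =
    L * al%:R * 'X^al * L ^+ be * p + 'X^al * (L * euler (L ^+ be)) * p +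
      L * 'X^al * L ^+ be * euler p by ring.
by rewrite eX; ring.
Qed.

Lemma size_log_euler {K : fieldType} (L : {poly K}) (al be i : nat) :
  (size L <= 2)%N -> (size (log_euler L al be i) <= i.+1)%N.
Proof.
move=> sL.
have sE (x : {poly K}) n : (size x <= n.+1)%N -> (size (euler x) <= n.+1)%N.
  move=> sx; apply/leq_sizeP => j lt_nj; rewrite -[euler x]/(iter 1 euler x).
  by rewrite coef_iter_euler (leq_sizeP _ _ sx) ?mul0r.
elim: i => [|i IH] /=; first by rewrite size_poly1.
have sM (x y : {poly K}) a b : (size x <= a.+1)%N -> (size y <= b.+1)%N ->
    (size (x * y)%R <= (a + b).+1)%N.
  by move=> sx sy; apply: leq_trans (size_polyMleq _ _) _; lia.
have sD (x y : {poly K}) a : (size x <= a)%N -> (size y <= a)%N -> (size (x + y)%R <= a)%N.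
  by move=> sx sy; apply: leq_trans (size_polyD _ _) _; rewrite geq_max sx sy.
have sN n : (size (n%:R : {poly K}) <= 1)%N by rewrite -polyC_natr size_polyC leq_b1.
apply: (sD _ _ _); last exact: (sM _ _ 1%N i sL (sE _ _ IH)).
apply: (sM _ _ 1%N i _ IH); apply: (sD _ _ _); first exact: (sM _ _ 0%N 1%N (sN _) sL).
by apply: (sM _ _ 0%N 1%N _ (sE _ _ sL)); apply: (sD _ _ _); rewrite ?size_polyN sN.
Qed.

(** Row [i] contributes degree at most [i] to each Leibniz term, and 0 + ... + (m - 1) =
    ['C(m, 2)]. *)
Lemma size_det_leq {K : fieldType} (m : nat) (M : 'M[{poly K}]_m) :
  (forall i j, (size (M i j) <= i.+1)%N) -> (size (\det M) <= 'C(m, 2).+1)%N.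
Proof.
move=> sM; apply: (leq_trans (size_sum _ _ _)); apply/bigmax_leqP => s _.
rewrite -polyC1 -polyCN -polyC_exp size_Cmul ?signr_eq0 //.
apply: (leq_trans (size_poly_prod_leq _ _)); rewrite card_ord.
rewrite leq_subLR addnS ltnS addnC.
have cardm : m = (\sum_(i < m) 1)%N by rewrite sum1_card card_ord.
rewrite -bin2_sum big_mkord [X in (_ <= _ + X)%N]cardm -big_split /=.
by apply: leq_sum => i _; rewrite addn1.
Qed.

(** * Order at 0 of sums of terms X^al L^be *)

Lemma independent_order_bound {K : fieldType} (char0 : [pchar K] =i pred0)
    (L : {poly K}) (m : nat) (al be : 'I_m -> nat) (a : 'I_m -> K) (r : 'I_m) (N : nat) :
  (size L <= 2)%N -> ~~ root L 0 ->
  (forall b : 'I_m -> K, \sum_j b j *: ('X^(al j) * L ^+ be j) = 0 -> forall j, b j = 0) ->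
  a r != 0 -> 'X^N %| \sum_j a j *: ('X^(al j) * L ^+ be j) ->
  (N <= al r + 'C(m, 2))%N.
Proof.
move=> sL rL indep ar; set f := \sum_j _ => dvdf.
pose M := \matrix_(i < m, j < m) log_euler L (al j) (be j) i.
have L0 : L != 0 by apply: contraNneq rL => ->; exact: root0.
have detM : \det M != 0.
  (* A left kernel vector [c] yields an operator with coefficients [c 0 i * L ^+ i] killing every
     term, against independence. *)
  apply/negP => /det0P [c c0 cM].
  have [i0 ci0] := rV0Pn _ c0.
  have [||b [[j bj] /indep b0]] := @euler_operator_dependence _ char0 m
    (fun i => c 0 i * L ^+ i) (fun j => 'X^(al j) * L ^+ be j) i0.
  - by rewrite mulf_neq0 ?expf_neq0.
  - move=> j; have := congr1 (fun v : 'rV_m => 'X^(al j) * L ^+ be j * v 0 j) cM.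
    rewrite !mxE mulr0 mulr_sumr; apply: etrans; apply: eq_bigr => i _.
    by rewrite -[LHS]mulrA log_eulerE [M i j]mxE; ring.
  by rewrite b0 eqxx in bj.
(* Cramer's rule: row [r] of [\adj M *m M] isolates the term [r] of [f]. *)
have key : a r *: ('X^(al r) * L ^+ be r) * \det M =
    \sum_i (\adj M) r i * (L ^+ i * iter i euler f).
  transitivity (\sum_j a j *: ('X^(al j) * L ^+ be j) * (\adj M *m M) r j).
    rewrite mul_adj_mx (bigD1 r) //= mxE eqxx mulr1n big1 ?addr0 // => j ne.
    by rewrite mxE eq_sym (negbTE ne) mulr0n mulr0.
  rewrite (eq_bigr (fun j => \sum_i \adj M r i *
      (a j *: (L ^+ i * iter i euler ('X^(al j) * L ^+ be j))))).
    rewrite exchange_big; apply: eq_bigr => i _ /=; rewrite -mulr_sumr iter_euler_sum.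
    by congr (_ * _); rewrite mulr_sumr; apply: eq_bigr => j _; rewrite scalerAr.
  move=> j _; rewrite mxE mulr_sumr; apply: eq_bigr => i _.
  by rewrite log_eulerE [M i j]mxE -scalerAl -scalerAr; congr (_ *: _); ring.
have : 'X^N %| a r *: ('X^(al r) * L ^+ be r) * \det M.
  rewrite key; apply: (big_ind (fun x => 'X^N %| x)) => [|x y|i _]; [exact: dvdp0|exact: dvdp_add|].
  by rewrite !dvdp_mull // dvdXn_iter_euler.
(* X is prime to L, so X^(N - al r) divides [\det M]; if [N <= al r], the truncated exponent is 0
   and the bound is trivial. *)
rewrite -scalerAl dvdpZr // -mulrA mulrC dvdp_exp_sub ?polyX_eq0 // Gauss_dvdpr.
  move=> /dvdp_leq -/(_ detM); rewrite size_polyXn => lt_size.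
  have : (size (\det M) <= 'C(m, 2).+1)%N.
    by apply: size_det_leq => i j; rewrite mxE size_log_euler.
  by move=> /(leq_trans lt_size); lia.
by rewrite coprimep_expl // coprimep_expr // coprimep_sym coprimepX.
Qed.

(** Terms are deleted until the first has a nonzero coefficient and all are independent. If that
    first term had index [i] originally, at most [m - i] terms are left. *)
Lemma order_bound {K : fieldType} (char0 : [pchar K] =i pred0)
    (L : {poly K}) (m : nat) (al be : 'I_m -> nat) (a : 'I_m -> K) (N : nat) :
  (size L <= 2)%N -> ~~ root L 0 ->
  \sum_j a j *: ('X^(al j) * L ^+ be j) != 0 ->
  'X^N %| \sum_j a j *: ('X^(al j) * L ^+ be j) ->
  exists i : 'I_m, (N <= al i + 'C(m - i, 2))%N.
Proof.
move=> sL rL; elim: m al be a => [|m IH] al be a; first by rewrite big_ord0 eqxx.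
have drop (b : 'I_m.+1 -> K) r : b r = 0 -> 
    \sum_j b j *: ('X^(al j) * L ^+ be j) != 0 ->
    'X^N %| \sum_j b j *: ('X^(al j) * L ^+ be j) ->
    exists i : 'I_m.+1, (N <= al i + 'C(m.+1 - i, 2))%N.
  move=> br; rewrite (bigD1_ord r) //= br scale0r add0r => h1 h2.
  have [i le_N] := IH _ _ _ h1 h2; exists (lift r i); apply: leq_trans le_N _.
  rewrite leq_add2l leq_bin2l //= /bump; case: (r <= i)%N; have := ltn_ord i; lia.
case: (eqVneq (a ord0) 0) => [a0|a0]; first exact: drop a0.
case: (excluded_middle_informative (exists2 b : 'I_m.+1 -> K,
   \sum_j b j *: ('X^(al j) * L ^+ be j) = 0 & exists j, b j != 0)).
  case=> b rel [r br] nz dv.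
  (* Subtracting [a r / b r] times the relation keeps the sum and kills its coefficient at [r]. *)
  have E : \sum_j a j *: ('X^(al j) * L ^+ be j) =
           \sum_j (a j - a r / b r * b j) *: ('X^(al j) * L ^+ be j).
    rewrite [RHS](eq_bigr (fun j => a j *: ('X^(al j) * L ^+ be j)
       - (a r / b r) *: (b j *: ('X^(al j) * L ^+ be j)))).
      by rewrite big_split /= sumrN -scaler_sumr rel scaler0 subr0.
    by move=> j _; rewrite scalerBl scalerA.
  move: nz dv; rewrite E; apply: (drop _ r).
  by rewrite divfK // subrr.
move=> indep _ dv; exists ord0; rewrite subn0.
apply: (independent_order_bound char0 _ _ al be a ord0 _ sL rL _ a0 dv) => b rel j.
apply/eqP; apply: contraT => bj; case: indep; exists b => //; by exists j.
Qed.

(** A nonzero Q(X, L) would have order at most [al i + 'C(l - i, 2)] for some [i], hence at most al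
    0 + ['C(i, 2) + 'C(l - i, 2)], which is at most al 0 + ['C(l, 2)]; but it equals -R(X, L),
    divisible by a higher power of X. *)
Lemma low_part_eq0 {K : fieldType} (char0 : [pchar K] =i pred0)
    (L : {poly K}) (k l : nat) (a : nat -> K) (al be : nat -> nat) :
  (size L <= 2)%N -> ~~ root L 0 ->
  (forall j : nat, (l <= j)%N -> (j < k)%N -> (al 0%N + 'C(l, 2) < al j)%N) ->
  (forall j : nat, (1 <= j)%N -> (j < l)%N -> (al j <= al 0%N + 'C(j, 2))%N) ->
  \sum_(0 <= j < l) a j *: ('X^(al j) * L ^+ be j) +
    \sum_(l <= j < k) a j *: ('X^(al j) * L ^+ be j) = 0 ->
  \sum_(0 <= j < l) a j *: ('X^(al j) * L ^+ be j) = 0.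
Proof.
move=> sL rL gap small PE; apply/eqP; apply: contraT => Q0.
have : 'X^((al 0%N + 'C(l, 2)).+1) %| \sum_(0 <= j < l) a j *: ('X^(al j) * L ^+ be j).
  move/eqP: PE; rewrite addr_eq0 => /eqP ->; rewrite dvdpNr big_nat.
  apply: (big_ind (fun x => _ %| x)) => [|x y|j /andP [le_lj lt_jk]].
  - exact: dvdp0.
  - exact: dvdp_add.
  by rewrite -mul_polyC dvdp_mull // dvdp_mulr // dvdp_exp2l // gap.
move: Q0; rewrite !big_mkord => Q0 dvdQ.
have [i] := @order_bound _ char0 L l (fun j => al j) (fun j => be j) (fun j => a j) _ sL rL Q0 dvdQ.
have bin2D p q : ('C(p, 2) + 'C(q, 2) <= 'C(p + q, 2))%N.
  elim: p => [|p IH]; first by rewrite add0n.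
  by rewrite addSn !binS !bin1; lia.
have := bin2D i (l - i)%N; rewrite subnKC ?(ltnW (ltn_ord i)) //.
by case: (posnP i) => [->|i0]; [|have := small i i0 (ltn_ord i)]; lia.
Qed.

(** * Substituting Y = L, and theta in the variable Y *)

Lemma horner_sum_bmono {K : fieldType} (i j : nat) (a : nat -> K) (al be : nat -> nat)
    (L : {poly K}) :
  (\sum_(i <= t < j) bmono (a t) (al t) (be t)).[L] =
  \sum_(i <= t < j) a t *: ('X^(al t) * L ^+ be t).
Proof.
rewrite horner_sum; apply: eq_bigr => t _.
by rewrite /bmono /bC /bX /bY -polyC_exp -polyCM hornerM hornerC hornerXn -mulrA mul_polyC.
Qed.

Lemma iter_euler_sum_bmono {K : fieldType} (n i j : nat) (a : nat -> K) (al be : nat -> nat) :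
  iter n euler (\sum_(i <= t < j) bmono (a t) (al t) (be t)) =
  \sum_(i <= t < j) bmono (a t * (be t)%:R ^+ n) (al t) (be t).
Proof.
apply/polyP => d; rewrite coef_iter_euler !coef_sum mulr_suml; apply: eq_bigr => t _.
rewrite /bmono /bC /bX /bY -!polyC_exp -!polyCM !coefCM coefXn.
case: eqP => [->|_]; last by rewrite !mulr0 mul0r.
by rewrite !mulr1 polyCM polyC_exp polyC_natr mulrAC.
Qed.

(** Each theta strips one factor Y - L, up to a summand that vanishes at Y = L in the end; the
    exponents n, ..., 1 multiply to n!. *)
Lemma horner_iter_euler_XsubC {R : comNzRingType} (L : R) (n : nat) (g : {poly R}) :
  (iter n euler (('X - L%:P) ^+ n * g)).[L] = n`!%:R * L ^+ n * g.[L].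
Proof.
elim: n g => [|n IH] g; first by rewrite !expr0 mul1r fact0 !mul1r.
rewrite iterSr.
have -> : euler (('X - L%:P) ^+ n.+1 * g) =
    ('X - L%:P) ^+ n * (n.+1%:R * 'X * g + ('X - L%:P) * euler g).
  rewrite /euler derivM deriv_exp /= derivXsubC mul1r exprS -mulr_natl; ring.
rewrite IH hornerD !hornerM hornerX hornerXsubC subrr mul0r addr0 -polyC_natr hornerC.
by rewrite factS natrM exprS; ring.
Qed.

(** As n! L^n is nonzero, theta^n P vanishes at Y = L exactly when the cofactor of (Y - L)^n
    does. *)
Lemma bdvd_XsubC_expS {K : fieldType} (char0 : [pchar K] =i pred0)
    (L : {poly K}) (n : nat) (P : bipoly K) :
  L != 0 -> bdvd (('X - L%:P) ^+ n) P ->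
  bdvd (('X - L%:P) ^+ n.+1) P <-> (iter n euler P).[L] = 0.
Proof.
move=> L0 [g ->]; rewrite horner_iter_euler_XsubC.
have D0 : ('X - L%:P) ^+ n != 0 by rewrite expf_neq0 ?polyXsubC_eq0.
split=> [[h] |].
  rewrite exprSr -[_ * _ * h]mulrA => E.
  by rewrite (mulfI D0 E) hornerM hornerXsubC subrr mul0r mulr0.
move/eqP; rewrite !mulf_eq0 expf_eq0 (negbTE L0) andbF orbF.
rewrite -polyC_natr polyC_eq0 ((pcharf0P _).1 char0).
rewrite gtn_eqF ?fact_gt0 //= => /factor_theorem [q ->].
by exists q; rewrite exprSr -mulrA [q * _]mulrC.
Qed.

(** * Multiplicities through divisibility by all powers *)

(** Encoding a multiplicity by all dividing powers turns a minimum into a conjunction. *)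
Definition is_mult {K : fieldType} (F P : bipoly K) (x : option nat) : Prop :=
  forall n, bdvd (F ^+ n) P <-> if x is Some m then (n <= m)%N else True.

Lemma bdvd_exp_leq {K : fieldType} (F P : bipoly K) (m n : nat) :
  (m <= n)%N -> bdvd (F ^+ n) P -> bdvd (F ^+ m) P.
Proof.
by move=> le_mn [g ->]; exists (F ^+ (n - m) * g); rewrite mulrA -exprD subnKC.
Qed.

Lemma multP {K : fieldType} (F P : bipoly K) : is_mult F P (mult F P).
Proof.
rewrite /mult; case: excluded_middle_informative => [ex|nex] n.
  case: constructive_indefinite_description => m [/= dv ndv].
  split=> [dvn|le_nm]; last exact: bdvd_exp_leq le_nm dv.
  by rewrite leqNgt; apply/negP => lt_mn; apply: ndv; exact: bdvd_exp_leq lt_mn dvn.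
split=> // _; elim: n => [|n IH]; first by exists P; rewrite expr0 mul1r.
by apply: NNPP => ndv; apply: nex; exists n.
Qed.

Lemma is_mult_unique {K : fieldType} (F P : bipoly K) (x y : option nat) :
  is_mult F P x -> is_mult F P y -> x = y.
Proof.
move=> hx hy; have xy n := iff_trans (iff_sym (hx n)) (hy n).
case: x y xy {hx hy} => [m|] [m'|] xy //.
- congr Some; apply/eqP; rewrite eqn_leq; apply/andP; split.
    exact/(xy m).
  exact/(xy m').
- by have := (xy m.+1).2 I; rewrite ltnn.
- by have := (xy m'.+1).1 I; rewrite ltnn.
Qed.

Lemma mult_omin {K : fieldType} (F P Q R : bipoly K) :
  (forall n, bdvd (F ^+ n) P <-> bdvd (F ^+ n) Q /\ bdvd (F ^+ n) R) ->
  mult F P = omin (mult F Q) (mult F R).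
Proof.
move=> split_dvd; apply: is_mult_unique (multP F P) _ => n.
apply: (iff_trans (split_dvd n)); move: (multP F Q n) (multP F R n).
case: (mult F Q) (mult F R) => [q|] [r|] /= -> ->; try tauto.
by rewrite leq_min; split=> [[-> ->]|/andP].
Qed.

Lemma bdvd_linear_exp {K : fieldType} (u v w : K) (P : bipoly K) (n : nat) :
  v != 0 ->
  bdvd ((bC u * bX + bC v * bY + bC w) ^+ n) P <->
  bdvd (('X - (- v^-1 *: (u *: 'X + w%:P))%:P) ^+ n) P.
Proof.
move=> v0; set L := - v^-1 *: _.
have -> : bC u * bX + bC v * bY + bC w = bC v * ('X - L%:P).
  rewrite /bC /bX /bY /L mulrBr -!polyCM -!mul_polyC mulrA -polyCM mulrN divff //.
  by rewrite polyCN mulN1r !polyCN opprK polyCD; ring.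
rewrite exprMn; split=> [] [g ->].
  by exists (bC v ^+ n * g); ring.
exists (bC v^-1 ^+ n * g).
have E : bC v ^+ n * bC v^-1 ^+ n = 1 by rewrite -exprMn /bC -!polyCM divff // expr1n.
by rewrite mulrCA !mulrA [_ ^+ n * bC v ^+ n]mulrC E mul1r.
Qed.

(* Indices are 0-based: j = 0, ..., k-1 corresponds to j+1 = 1, ..., k in the paper;
   l is the paper's ell, so Q uses paper indices 1..l (0-based 0..l-1). *)
Theorem theorem3p1 (K : fieldType) (charK0 : [pchar K] =i pred0)
  (k : nat) (a : nat -> K) (alpha beta : nat -> nat)
  (alpha_sorted : forall i j : nat, (i <= j)%N -> (j < k)%N -> (alpha i <= alpha j)%N)
  (l : nat) (hl1 : (1 <= l)%N) (hlk : (l < k)%N)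
  (hl_gt : (alpha l > alpha 0%N + 'C(l, 2))%N)
  (hl_min : forall l' : nat, (1 <= l')%N -> (l' < l)%N ->
              (alpha l' <= alpha 0%N + 'C(l', 2))%N)
  (u v w : K) (huvw : u * v * w != 0) :
  let Q : bipoly K := \sum_(0 <= j < l) bmono (a j) (alpha j) (beta j) in
  let R : bipoly K := \sum_(l <= j < k) bmono (a j) (alpha j) (beta j) in
  let P : bipoly K := Q + R in
  let F : bipoly K := bC u * bX + bC v * bY + bC w in
  mult F P = omin (mult F Q) (mult F R).
Proof.
move=> Q R P F; apply: mult_omin => n.
move: huvw; rewrite !mulf_eq0 !negb_or => /andP [/andP [u0 v0] w0].
have dvdE A m := @bdvd_linear_exp K u v w A m v0.
rewrite -/F in dvdE; set L := - v^-1 *: _ in dvdE.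
have sL : (size L <= 2)%N.
  apply: leq_trans (size_scale_leq _ _) _; apply: leq_trans (size_polyD _ _) _.
  rewrite geq_max (leq_trans (size_scale_leq _ _)) ?size_polyX //=.
  by rewrite (leq_trans (size_polyC_leq1 _)).
have rL : ~~ root L 0.
  by rewrite /root !hornerE mulf_neq0 // oppr_eq0 invr_eq0.
have L0 : L != 0 by apply: contraNneq rL => ->; exact: root0.
have bdvdB A B C : bdvd A B -> bdvd A (B + C) -> bdvd A C.
  by move=> [g ->] [h E]; exists (h - g); rewrite mulrBr -E addrAC subrr add0r.
split; last by case=> [[g Eg] [h Eh]]; exists (g + h); rewrite /P Eg Eh mulrDr.
(* R = P - Q, so only Q needs care. *)
suff PQ : bdvd (F ^+ n) P -> bdvd (F ^+ n) Q.
  by move=> dP; split; [exact: PQ | exact: bdvdB (PQ dP) dP].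
elim: n => [|n IH]; first by exists Q; rewrite expr0 mul1r.
move=> dP1; have dP := @bdvd_exp_leq _ _ _ _ _ (leqnSn n) dP1; have dQ := IH dP.
move: dP1 dP dQ; rewrite !dvdE => dP1 dP dQ.
apply/(bdvd_XsubC_expS charK0 _ _ _ L0 dQ).
have PE : P = \sum_(0 <= j < k) bmono (a j) (alpha j) (beta j).
  by rewrite /P /Q /R -big_cat_nat // ltnW.
move/(bdvd_XsubC_expS charK0 _ _ _ L0 dP): dP1.
(* Both divisibilities are now values of theta^n at Y = L; only the coefficients have changed, so
   the gap in the exponents still applies. *)
rewrite PE !iter_euler_sum_bmono (@big_cat_nat _ _ _ l) //=; last exact: ltnW.
rewrite hornerD !(horner_sum_bmono _ _ (fun t => a t * (beta t)%:R ^+ n)).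
apply: low_part_eq0 => // j le_lj lt_jk.
exact: leq_trans hl_gt (alpha_sorted _ _ le_lj lt_jk).
Qed.
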